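(* Let $K$ be a real biquadratic field of type I. Then the log-unit lattice $\Lambda_K$ is orthogonal.
   Context: A real biquadratic field is $K=\mathbb{Q}(\sqrt{d_1},\sqrt{d_2})$ with $d_1,d_2>0$ rational and none of $d_1,d_2,d_1d_2$ a square in $\mathbb{Q}$. Its Galois group is generated by $\sigma,\tau$ with $\sigma(\sqrt{d_1})=-\sqrt{d_1}$, $\sigma(\sqrt{d_2})=\sqrt{d_2}$, $\tau(\sqrt{d_1})=\sqrt{d_1}$, $\tau(\sqrt{d_2})=-\sqrt{d_2}$. Fix $K\subset\mathbb{R}$ and define $\mathrm{Log}(x)=(\log|x|,\log|\tau(x)|,\log|\sigma(x)|,\log|\sigma\tau(x)|)\in\mathbb{R}^4$; $\Lambda_K=\mathrm{Log}(\mathcal{O}_K^\times)$. Units $u_1,u_2,u_3$ form a system of fundamental units if their Logs form a basis of $\Lambda_K$. Let $\epsilon_i$ be a fundamental unit of $K_i$, where $K_1=\mathbb{Q}(\sqrt{d_1})$, $K_2=\mathbb{Q}(\sqrt{d_2})$, $K_3=\mathbb{Q}(\sqrt{d_1d_2})$; $\sqrt{\alpha}$ denotes an element of $K$ with square $\alpha$. $K$ is of type I if, up to permutation of indices, one of $\epsilon_1,\epsilon_2,\epsilon_3$; $\sqrt{\epsilon_1},\epsilon_2,\epsilon_3$; $\sqrt{\epsilon_1},\sqrt{\epsilon_2},\epsilon_3$ is a system of fundamental units. A lattice is orthogonal if it has a basis of pairwise orthogonal vectors (standard inner product). *)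

(* Defs.v *)
From HB Require Import structures.
From mathcomp Require Import all_boot all_order all_algebra all_fingroup.
From mathcomp Require Import all_solvable all_field.
From mathcomp Require Import all_classical all_reals all_analysis.

Set Implicit Arguments.
Unset Strict Implicit.
Unset Printing Implicit Defensive.

Import Order.TTheory GRing.Theory Num.Theory.

Local Open Scope classical_set_scope.
Local Open Scope ring_scope.

(* The abstract extension [bq_field] is identified by [bq_emb] with the subfield
   Q(sqrt d1, sqrt d2) of R. The automorphisms [bq_sigma] and [bq_tau] are not
   extra data: their values on the two square roots determine them. *)
Record realBiquadratic (R : realType) := RealBiquadratic {
  bq_field :> splittingFieldType rat;
  bq_emb : {rmorphism bq_field -> R};
  bq_d1 : rat;
  bq_d2 : rat;
  bq_d1_gt0 : 0 < bq_d1;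
  bq_d2_gt0 : 0 < bq_d2;
  bq_d1_nsquare : ~ exists q : rat, bq_d1 = q ^+ 2;
  bq_d2_nsquare : ~ exists q : rat, bq_d2 = q ^+ 2;
  bq_d12_nsquare : ~ exists q : rat, bq_d1 * bq_d2 = q ^+ 2;
  bq_sqrt1 : bq_field;
  bq_sqrt2 : bq_field;
  bq_emb_sqrt1 : bq_emb bq_sqrt1 = Num.sqrt (ratr bq_d1);
  bq_emb_sqrt2 : bq_emb bq_sqrt2 = Num.sqrt (ratr bq_d2);
  bq_gen : <<1 & [:: bq_sqrt1; bq_sqrt2]>>%VS = {:bq_field}%VS;
  bq_sigma : gal_of {:bq_field}%VS;
  bq_tau : gal_of {:bq_field}%VS;
  bq_sigma1 : bq_sigma bq_sqrt1 = - bq_sqrt1;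
  bq_sigma2 : bq_sigma bq_sqrt2 = bq_sqrt2;
  bq_tau1 : bq_tau bq_sqrt1 = bq_sqrt1;
  bq_tau2 : bq_tau bq_sqrt2 = - bq_sqrt2
}.

Definition algebraic_integer (L : fieldExtType rat) (x : L) : Prop :=
  integralOver (intr : int -> L) x.

(* The condition [x != 0] is needed since 0^-1 = 0. *)
Definition integer_unit (L : fieldExtType rat) (x : L) : Prop :=
  [/\ x != 0, algebraic_integer x & algebraic_integer x^-1].

(* For F a real quadratic subfield of L: the units of F are the +-e^n. *)
Definition fundamental_unit (L : fieldExtType rat) (F : {vspace L}) (e : L) :
    Prop :=
  [/\ e \in F, integer_unit e &
      forall u : L, u \in F -> integer_unit u ->
        exists n : int, u = e ^ n \/ u = - e ^ n].

Definition lattice_basis (R : realType) (m n : nat) (b : n.-tuple 'rV[R]_m)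
    (L : set 'rV[R]_m) : Prop :=
  free b /\ L = [set v | inIntSpan b v].

Definition dotprod (R : realType) (m : nat) (u v : 'rV[R]_m) : R :=
  \sum_(k < m) u 0 k * v 0 k.

Definition orthogonal_lattice (R : realType) (m : nat) (L : set 'rV[R]_m) :
    Prop :=
  exists (n : nat) (b : n.-tuple 'rV[R]_m), lattice_basis b L /\
    forall i j : 'I_n, i != j -> dotprod (tnth b i) (tnth b j) = 0.

Section LogUnitLattice.
Variables (R : realType) (K : realBiquadratic R).

Definition Log (x : K) : 'rV[R]_4 :=
  let conj := [tuple x; bq_tau K x; bq_sigma K x; bq_sigma K (bq_tau K x)] in
  \row_(i < 4) ln `|bq_emb K (tnth conj i)|.

Definition log_unit_lattice : set 'rV[R]_4 :=
  Log @` [set x : K | integer_unit x].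

Definition fundamental_units (u1 u2 u3 : K) : Prop :=
  [/\ integer_unit u1, integer_unit u2, integer_unit u3 &
      lattice_basis [tuple Log u1; Log u2; Log u3] log_unit_lattice].

Definition quadratic_subfields : 3.-tuple {vspace K} :=
  [tuple <<1; bq_sqrt1 K>>%VS; <<1; bq_sqrt2 K>>%VS;
         <<1; bq_sqrt1 K * bq_sqrt2 K>>%VS].

Definition typeI : Prop :=
  exists (e : 'I_3 -> K) (s : 'S_3),
    (forall i, fundamental_unit (tnth quadratic_subfields i) (e i)) /\
    let e1 := e (s (inord 0)) in
    let e2 := e (s (inord 1)) in
    let e3 := e (s (inord 2)) in
    [\/ fundamental_units e1 e2 e3,
        exists2 r1 : K, r1 ^+ 2 = e1 & fundamental_units r1 e2 e3 |
        exists r1 r2 : K, [/\ r1 ^+ 2 = e1, r2 ^+ 2 = e2 &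
                              fundamental_units r1 r2 e3]].

End LogUnitLattice.

(* Main.v *)
(* For a unit e of a quadratic subfield Q(x), x^2 = d, write e = a + b x.  The
   product of e with its conjugate a - b x is the rational number a^2 - b^2 d,
   which is a unit of Z, that is +-1; so conjugation negates log |e|.  Hence Log
   maps the units of the three quadratic subfields into the lines spanned by
   (1,1,-1,-1), (1,-1,1,-1) and (1,-1,-1,1), which are pairwise orthogonal, and extracting a
   square root of a unit halves its Log, which preserves orthogonality. *)
Require Import Defs.
From mathcomp Require Import all_boot all_order all_algebra.
From mathcomp Require Import all_fingroup all_field.
From mathcomp Require Import all_classical all_reals all_analysis.
From mathcomp Require Import ring.

Set Implicit Arguments.
Unset Strict Implicit.
Unset Printing Implicit Defensive.

Import Order.TTheory GRing.Theory Num.Theory.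

Local Open Scope ring_scope.

Section FieldExtension.
Variable L : fieldExtType rat.
Implicit Types (q d a b : rat) (x e : L).

(** An integer polynomial keeps its coefficients under any ring morphism ([map_intr]), so a monic
    equation for [q%:A] in [L] descends to [rat] and moves up to [algC], where a rational algebraic
    integer is known to be an integer. *)
Lemma algebraic_integer_rat q : algebraic_integer (q%:A : L) -> q \is a Num.int.
Proof.
have map_intr (A B : unitRingType) (h : {rmorphism A -> B}) (p : {poly int}) :
    map_poly h (map_poly intr p) = map_poly intr p.
  by rewrite -map_poly_comp; apply: eq_map_poly => n /=; rewrite rmorph_int.
case=> p p_monic; rewrite -(map_intr _ _ (in_alg L)) -in_algE fmorph_root => p_root.
have: (ratr q : algC) \in Aint.
  apply: (@root_monic_Aint (map_poly intr p)).
  - by rewrite -(map_intr _ _ (@ratr algC)) fmorph_root.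
  - by rewrite monic_map.
  - by apply/polyOverP=> i; rewrite coef_map /= intr_int.
move/(Cint_rat_Aint (Crat_rat q))/intrP=> [n qn]; apply/intrP; exists n.
by apply: (fmorph_inj (@ratr algC)); rewrite rmorph_int -qn.
Qed.

Lemma integer_unit_rat q : integer_unit (q%:A : L) -> `|q| = 1.
Proof.
rewrite /integer_unit scaler_eq0 oner_eq0 orbF => -[q0 + ].
rewrite -in_algE -fmorphV => /algebraic_integer_rat/intrP[m qm].
move=> /algebraic_integer_rat/intrP[n qn].
have : m * n = 1.
  by apply: (@intr_inj rat); rewrite intrM -qm -qn mulfV.
move/(congr1 absz)/eqP; rewrite abszM muln_eq1 => /andP[/eqP m1 _].
by rewrite qm -intr_norm -abszE m1.
Qed.

Lemma quadratic_subfieldP x d e : x ^+ 2 = d%:A -> e \in <<1; x>>%VS ->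
  exists a b, e = a%:A + b *: x.
Proof.
move=> x2 /Fadjoin_polyP[_ /polyOver1P[p ->] ->].
elim/poly_ind: p => [|p c [a [b e_ab]]].
  by exists 0, 0; rewrite rmorph0 horner0 !scale0r addr0.
(* Horner step: (a + b x) x + c = (b d + c) + a x, since x^2 = d. *)
exists (b * d + c), a.
rewrite rmorphD rmorphM /= map_polyX map_polyC /= hornerD hornerM hornerX hornerC.
rewrite e_ab mulrDl -!scalerAl mul1r -expr2 x2 scalerA scalerDl.
by rewrite -addrA addrC.
Qed.

End FieldExtension.

Lemma integer_unit_rmorph (L M : fieldExtType rat) (f : {rmorphism L -> M}) u :
  integer_unit u -> integer_unit (f u).
Proof.
have f_int x : algebraic_integer x -> algebraic_integer (f x).
  case=> p p_monic p_root; exists p => //.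
  suff -> : map_poly intr p = map_poly f (map_poly intr p) by rewrite fmorph_root.
  by rewrite -map_poly_comp; apply: eq_map_poly => n /=; rewrite rmorph_int.
by case=> u0 u_int uV_int; split; rewrite ?fmorph_eq0 -?fmorphV //; apply: f_int.
Qed.

Lemma integer_unitM (L : fieldExtType rat) (u v : L) :
  integer_unit u -> integer_unit v -> integer_unit (u * v).
Proof.
case=> u0 ui uVi [v0 vi vVi]; split; first by rewrite mulf_neq0.
  exact: integral_mul.
by rewrite invfM; apply: integral_mul.
Qed.

Section QuadraticUnits.
Variables (R : realType) (L : splittingFieldType rat) (f : {rmorphism L -> R}).
Implicit Types (g : gal_of {:L}%VS) (x e : L).

Lemma gal_quadratic_fixed g x d e : x ^+ 2 = d%:A -> e \in <<1; x>>%VS ->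
  g x = x -> g e = e.
Proof.
move=> x2 /(quadratic_subfieldP x2)[a [b ->]] gx.
by rewrite linearD !linearZ /= rmorph1 gx.
Qed.

Lemma ln_conjugate g x d e : x ^+ 2 = d%:A -> e \in <<1; x>>%VS ->
  g x = - x -> integer_unit e -> ln `|f (g e)| = - ln `|f e|.
Proof.
move=> x2 e_x gx e_unit; have [a [b e_ab]] := quadratic_subfieldP x2 e_x.
have norm_e : e * g e = (a ^+ 2 - b ^+ 2 * d)%:A.
  rewrite e_ab linearD !linearZ /= rmorph1 gx scalerN mulrC -subr_sqr !exprZn x2.
  by rewrite expr1n scalerA scalerBl.
have := integer_unitM e_unit (integer_unit_rmorph g e_unit).
rewrite norm_e => /integer_unit_rat norm1; have [e0 _ _] := e_unit.
have [ge0 _ _] := integer_unit_rmorph g e_unit.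
(* The two logarithms add up to that of the absolute norm, which is 1; [ln] is additive only on
   positive reals, hence the nonvanishing facts above. *)
apply/eqP; rewrite -addr_eq0 addrC -lnM ?posrE ?normr_gt0 ?fmorph_eq0 //.
rewrite -normrM -rmorphM norm_e rmorphZ_num rmorph1 mulr1.
by rewrite -ratr_norm norm1 rmorph1 ln1.
Qed.

End QuadraticUnits.

Lemma dotprodC (R : realType) m (u v : 'rV[R]_m) : dotprod u v = dotprod v u.
Proof. by apply: eq_bigr => k _; rewrite mulrC. Qed.

Lemma dotprodZl (R : realType) m c (u v : 'rV[R]_m) :
  dotprod (c *: u) v = c * dotprod u v.
Proof. by rewrite /dotprod mulr_sumr; apply: eq_bigr => k _; rewrite mxE mulrA. Qed.

Lemma orthogonal_lattice3 (R : realType) m (u v w : 'rV[R]_m) L :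
  lattice_basis [tuple u; v; w] L ->
  dotprod u v = 0 -> dotprod u w = 0 -> dotprod v w = 0 ->
  orthogonal_lattice L.
Proof.
move=> basisL uv uw vw; exists 3, [tuple u; v; w]; split=> //.
by case=> [[|[|[|//]]] ?] [[|[|[|//]]] ?] //= _; rewrite !(tnth_nth 0) //= dotprodC.
Qed.

Section LogUnits.
Variables (R : realType) (K : realBiquadratic R).
Implicit Types (x e r : K).

Lemma ratr_sqrt_sqr (d : rat) x : 0 < d -> bq_emb K x = Num.sqrt (ratr d) ->
  x ^+ 2 = d%:A.
Proof.
move=> d_gt0 x_sqrt; apply: (fmorph_inj (bq_emb K)).
rewrite rmorphXn /= x_sqrt sqr_sqrtr ?ler0q ?ltW //.
by rewrite rmorphZ_num rmorph1 mulr1.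
Qed.

Lemma Log_sqr r e : r != 0 -> r ^+ 2 = e -> Log e = 2 *: Log r.
Proof.
move=> r0 <-; apply/rowP=> k; rewrite !mxE.
suff ln_sqr (y z : K) : z != 0 -> y = z ^+ 2 ->
    ln `|bq_emb K y| = 2 * ln `|bq_emb K z|.
  by case: k => [[|[|[|[|//]]]] ?]; rewrite !(tnth_nth 0) /=; apply: ln_sqr;
    rewrite ?fmorph_eq0 // !rmorphXn.
by move=> z0 ->; rewrite rmorphXn normrX lnXn ?normr_gt0 ?fmorph_eq0 // mulr_natl.
Qed.

(** The booleans record the signs by which tau and sigma act on [x], so that one statement serves
    all three subfields. The row lists the signs of the identity, tau, sigma and their composite, in
    the order of the coordinates of [Log]. *)
Lemma Log_quadratic_unit x d e (c1 c2 : bool) : x ^+ 2 = d%:A ->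
  bq_tau K x = (-1) ^+ c1 * x -> bq_sigma K x = (-1) ^+ c2 * x ->
  e \in <<1; x>>%VS -> integer_unit e ->
  Log e = ln `|bq_emb K e| *:
    \row_k [tuple 1; (-1) ^+ c1; (-1) ^+ c2; (-1) ^+ (c1 (+) c2)]`_k.
Proof.
move=> x2 taux sigmax e_x e_unit.
have act (g : gal_of {:K}%VS) (c : bool) : g x = (-1) ^+ c * x ->
    ln `|bq_emb K (g e)| = ln `|bq_emb K e| * (-1) ^+ c.
  case: c; rewrite ?mulN1r ?mul1r => gx.
    by rewrite mulrN1; apply: ln_conjugate x2 _ gx _.
  by rewrite mulr1 (gal_quadratic_fixed x2 e_x gx).
(* The group product of automorphisms applies its left factor first. Writing the fourth conjugate as
   the image under a single automorphism makes [act] applicable to it. *)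
have sigmatau : bq_sigma K (bq_tau K e) = (bq_tau K * bq_sigma K)%g e.
  by rewrite galM ?memvf.
apply/rowP=> k; rewrite !mxE.
case: k => [[|[|[|[|//]]]] ?]; rewrite !(tnth_nth 0) /= ?mulr1 ?sigmatau //.
- exact: act.
- exact: act.
apply: act; rewrite galM ?memvf // taux rmorphM rmorph_sign /= sigmax.
by rewrite signr_addb mulrA.
Qed.

Lemma dotprod_Log_units (e : 'I_3 -> K) :
  (forall i, fundamental_unit (tnth (quadratic_subfields K) i) (e i)) ->
  forall i j, i != j -> dotprod (Log (e i)) (Log (e j)) = 0.
Proof.
move=> e_fund.
have x1 := ratr_sqrt_sqr (bq_d1_gt0 K) (bq_emb_sqrt1 K).
have x2 := ratr_sqrt_sqr (bq_d2_gt0 K) (bq_emb_sqrt2 K).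
have x3 : (bq_sqrt1 K * bq_sqrt2 K) ^+ 2 = (bq_d1 K * bq_d2 K)%:A.
  by rewrite exprMn x1 x2 -scalerAl mul1r scalerA.
(* Only the direction of each vector matters, so the scalar stays existential; the sign patterns
   belong to sqrt d1, sqrt d2 and their product. *)
have Log_e i : exists l : R, Log (e i) = l *: \row_k (nth [::] [::
      [:: 1; 1; -1; -1]; [:: 1; -1; 1; -1]; [:: 1; -1; -1; 1]] i)`_k.
  have [] := e_fund i; case: i => [[|[|[|//]]] i3] e_x e_unit _; eexists.
  - apply: etrans (Log_quadratic_unit (c1 := false) (c2 := true) x1 _ _ e_x e_unit) _.
    + by rewrite bq_tau1 mul1r.
    + by rewrite bq_sigma1 mulN1r.
    + by [].
  - apply: etrans (Log_quadratic_unit (c1 := true) (c2 := false) x2 _ _ e_x e_unit) _.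
    + by rewrite bq_tau2 mulN1r.
    + by rewrite bq_sigma2 mul1r.
    + by [].
  - apply: etrans (Log_quadratic_unit (c1 := true) (c2 := true) x3 _ _ e_x e_unit) _.
    + by rewrite rmorphM /= bq_tau1 bq_tau2 mulrN mulN1r.
    + by rewrite rmorphM /= bq_sigma1 bq_sigma2 mulNr mulN1r.
    + by [].
move=> i j ij; have [l ->] := Log_e i; have [m ->] := Log_e j.
rewrite dotprodZl dotprodC dotprodZl /dotprod !big_ord_recl big_ord0 !mxE.
(* For distinct sign patterns, two of the four products are +1 and two are -1, so they cancel. *)
by case: i j ij => [[|[|[|//]]] ?] [[|[|[|//]]] ?] //= _; ring.
Qed.

End LogUnits.

Theorem theorem3p1 (R : realType) (K : realBiquadratic R) (hK : typeI K) :
  orthogonal_lattice (log_unit_lattice K).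
Proof.
have [e [s [/dotprod_Log_units e_orth] /=]] := hK.
(* A permutation is injective, so reindexing keeps distinct units distinct. *)
have s_orth i j (ij : i != j) :=
  e_orth (s i) (s j) (contra_neq (@perm_inj _ s i j) ij).
have [n01 n02 n12] : [/\ inord 0 != inord 1 :> 'I_3, inord 0 != inord 2 :> 'I_3
    & inord 1 != inord 2 :> 'I_3] by rewrite -!val_eqE /= !inordK.
(* Since Log e' = 2 Log r, the factor 2 can be cancelled from a vanishing product. *)
have orth_sqrt (r e' : K) (v : 'rV[R]_4) : r != 0 -> r ^+ 2 = e' ->
    dotprod (Log e') v = 0 -> dotprod (Log r) v = 0.
  move=> r0 /(Log_sqr r0) ->; rewrite dotprodZl => /eqP.
  by rewrite mulf_eq0 pnatr_eq0 => /eqP.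
case.
- by move=> [_ _ _ /orthogonal_lattice3]; apply; apply: s_orth.
- move=> [r r2 [[r0 _ _] _ _ /orthogonal_lattice3]]; apply.
  + exact: orth_sqrt r0 r2 (s_orth _ _ n01).
  + exact: orth_sqrt r0 r2 (s_orth _ _ n02).
  + exact: s_orth.
- move=> [r1 [r2 [r1e r2e [[r10 _ _] [r20 _ _] _ /orthogonal_lattice3]]]]; apply.
  (* Both arguments are logs of square roots here: one root is squared away on the left, then
     symmetry brings the other to the left. *)
  + apply: (orth_sqrt _ _ _ r10 r1e); rewrite dotprodC.
    by apply: (orth_sqrt _ _ _ r20 r2e); rewrite dotprodC; apply: s_orth.
  + exact: orth_sqrt r10 r1e (s_orth _ _ n02).
  + exact: orth_sqrt r20 r2e (s_orth _ _ n12).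
Qed.
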